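(* Let $W\in\mathbb{R}$. Let $g(W)$ be the optimal average reward of the (single-user) relaxed POMDP with original dynamics and $g^{app}(W)$ the optimal average reward of the approximation, and let $g^{max}(W)$ and $g^{min}(W)$ be as defined in the context. Then $$\bigg|1-\frac{g^{app}(W)}{g(W)}\bigg|\le D(W),\qquad D(W):=\max\left\{1-\frac{g^{app}(W)}{g^{max}(W)},\ \frac{g^{app}(W)}{g^{min}(W)}-1\right\}.$$
   Context: Let $K\ge1$ and let $P=(p_{ij})$ be a $K\times K$ stochastic matrix with powers $p_{ij}^{(\tau)}=(P^\tau)_{ij}$ and steady-state distribution $(p_1^s,\dots,p_K^s)$ (assumed to exist). Belief states $\vec\pi_j^\tau=\vec e_jP^\tau$, $j\in\{1,\dots,K\}$, $\tau\ge1$, are labelled by the pairs $(j,\tau)$. $R(\vec\pi_j^\tau,1)=R^1$ and $R(\vec\pi_j^\tau,0)$ are the average immediate rewards under the active and passive action. Standing assumptions: $\max_i p_{ji}^{(\tau)}\ge \max_i p_{ji}^{(\tau')}$ for $\tau\le\tau'$; $R^1<\infty$ and $R^1\ge R(\vec\pi_j^{\tau},0)\ge R(\vec\pi_j^{\tau'},0)\ge0$ for $\tau\le\tau'$; $W$ is a subsidy received in each passive slot. For $0\le\beta<1$ let $V_\beta,V_\beta^{app},V_\beta^{max},V_\beta^{min}$ be the bounded functions on belief states solving $$V(\vec\pi_j^\tau)=\max\big\{R(\vec\pi_j^\tau,0)+W+\beta V(\vec\pi_j^{\tau+1});\ R^1+\beta\,C_j^\tau(V)\big\}$$ with, respectively,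 $C_j^\tau(V)=\sum_{i}p_{ji}^{(\tau)}V(\vec\pi_i^1)$ (original problem), $C_j^\tau(V)=\sum_kp_k^sV(\vec\pi_k^1)$ (approximation), $C_j^\tau(V)=\max_iV(\vec\pi_i^1)$, and $C_j^\tau(V)=\min_iV(\vec\pi_i^1)$. Set $g(W)=\lim_{\beta\to1}(1-\beta)V_\beta(\cdot)$, $g^{app}(W)=\lim_{\beta\to1}(1-\beta)V_\beta^{app}(\cdot)$, $g^{max}(W)=\lim_{\beta\to1}(1-\beta)V_\beta^{max}(\cdot)$, $g^{min}(W)=\lim_{\beta\to1}(1-\beta)V_\beta^{min}(\cdot)$, the optimal average rewards of the corresponding problems (the limits are taken to exist and to be independent of the state, and the denominators to be nonzero). *)

(* Defs.v *)
From HB Require Import structures.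
From mathcomp Require Import all_boot all_order all_algebra.
From mathcomp Require Import all_classical all_reals all_analysis.
Import Order.TTheory GRing.Theory Num.Theory.
Import numFieldNormedType.Exports.

Set Implicit Arguments.
Unset Strict Implicit.
Unset Printing Implicit Defensive.

Local Open Scope classical_set_scope.
Local Open Scope ring_scope.

(* The chain has n.+1 states, so that there is at least one.  Belief states are
   row vectors; only the vectors belief P j tau with 1 <= tau count as such. *)
Section Model.
Context {R : realType} {n : nat}.
Implicit Types (P : 'M[R]_n.+1) (V : 'rV[R]_n.+1 -> R).

Definition is_distribution (q : 'rV[R]_n.+1) : Prop :=
  (forall k, 0 <= q 0 k) /\ \sum_k q 0 k = 1.

Definition is_stochastic P : Prop := forall i, is_distribution (row i P).

(* Stationarity; a common limit of the rows of P ^+ tau is stationary. *)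
Definition is_steady_state P (ps : 'rV[R]_n.+1) : Prop :=
  is_distribution ps /\ ps *m P = ps.

Definition belief P (j : 'I_n.+1) (tau : nat) : 'rV[R]_n.+1 :=
  delta_mx 0 j *m P ^+ tau.

Definition max_ord (F : 'I_n.+1 -> R) : R :=
  \big[Num.max/F ord0]_(i < n.+1) F i.

Definition min_ord (F : 'I_n.+1 -> R) : R :=
  \big[Num.min/F ord0]_(i < n.+1) F i.

(* C V j tau is the term C_j^tau(V) that beta multiplies under the active action. *)
Definition continuation := ('rV[R]_n.+1 -> R) -> 'I_n.+1 -> nat -> R.

Definition cont_orig P : continuation := fun V j tau =>
  \sum_i (P ^+ tau) j i * V (belief P i 1).

Definition cont_app P (ps : 'rV[R]_n.+1) : continuation := fun V _ _ =>
  \sum_k ps 0 k * V (belief P k 1).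

Definition cont_max P : continuation := fun V _ _ =>
  max_ord (fun i => V (belief P i 1)).

Definition cont_min P : continuation := fun V _ _ =>
  min_ord (fun i => V (belief P i 1)).

Definition bounded_on_beliefs P V : Prop :=
  exists M, forall j tau, (1 <= tau)%N -> `|V (belief P j tau)| <= M.

(* In rew, true is the active action and false the passive one. *)
Definition bellman P (rew : 'rV[R]_n.+1 -> bool -> R) (W beta : R)
    (C : continuation) V : Prop :=
  forall j tau, (1 <= tau)%N ->
    V (belief P j tau) =
      Num.max (rew (belief P j tau) false + W + beta * V (belief P j tau.+1))
              (rew (belief P j tau) true + beta * C V j tau).

(* For 0 <= beta < 1 the right-hand side of the Bellman equation is a
   beta-contraction in the supremum norm for each of the four continuations, so
   these conditions determine V beta on belief states. *)
Definition is_value_function P rew W C (V : R -> 'rV[R]_n.+1 -> R) : Prop :=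
  forall beta, 0 <= beta < 1 ->
    bounded_on_beliefs P (V beta) /\ bellman P rew W beta C (V beta).

Definition is_average_reward P (V : R -> 'rV[R]_n.+1 -> R) (g : R) : Prop :=
  forall j tau, (1 <= tau)%N ->
    (1 - beta) * V beta (belief P j tau) @[beta --> (1 : R)^'-] --> g.

End Model.

(* Main.v *)
Require Import Defs.
From HB Require Import structures.
From mathcomp Require Import all_boot all_order all_algebra.
From mathcomp Require Import all_classical all_reals all_analysis.
Import Order.TTheory GRing.Theory Num.Theory.
Import numFieldNormedType.Exports.

Local Open Scope classical_set_scope.
Local Open Scope ring_scope.

(** The ratio bound comes from the ordering
      0 < gmin <= g <= gmax,    gmin <= gapp
    of the four average rewards.  Granted that, if gapp <= g then g <= gmax and
    0 <= gapp give |1 - gapp / g| = 1 - gapp / g <= 1 - gapp / gmax, and if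
    g <= gapp then gmin <= g gives
    |1 - gapp / g| = gapp / g - 1 <= gapp / gmin - 1.

    The ordering is inherited from the discounted problems through a comparison
    principle ([bellman_comparison]).  The original and the approximate
    continuations are averages of the values V (belief P i 1), so they lie
    between the minimum and the maximum of these values.  Suppose that V1
    exceeds V2 by at most c >= 0 on belief states, and that the continuation
    of V1 is dominated by the one of V2.  One Bellman step then shows that V1
    exceeds V2 by at most beta * c.  Iterating from any bound on V1 - V2 gives
    V1 <= V2 ([contraction_le0]).  Multiplying by 1 - beta and letting beta tend
    to 1 gives the inequalities between the averages.

    For the sign of gmin, the zero function is a subsolution of the minimum
    problem, because always choosing the active action earns R1 >= 0 per slot.
    So the same comparison gives 0 <= gmin, and gmin is nonzero. *)

Section Comparison.
Context {R : realType} {n : nat}.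
Implicit Types (P : 'M[R]_n.+1) (V : 'rV[R]_n.+1 -> R) (F : 'I_n.+1 -> R).
Implicit Types (rew : 'rV[R]_n.+1 -> bool -> R) (W beta x c : R).

Lemma min_ord_le F i : min_ord F <= F i.
Proof. by rewrite /min_ord; apply: bigmin_le_cond. Qed.

Lemma le_max_ord F i : F i <= max_ord F.
Proof. by rewrite /max_ord; apply: le_bigmax_cond. Qed.

Lemma le_min_ord F x : (forall i, x <= F i) -> x <= min_ord F.
Proof. by move=> xF; rewrite /min_ord; apply: le_bigmin. Qed.

Lemma average_le (q : 'rV[R]_n.+1) F x :
  is_distribution q -> (forall i, F i <= x) -> \sum_i q 0 i * F i <= x.
Proof.
move=> [q0 q1] Fx; rewrite -[leRHS]mul1r -q1 mulr_suml.
by apply: ler_sum => i _; apply: ler_wpM2l.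
Qed.

Lemma average_ge (q : 'rV[R]_n.+1) F x :
  is_distribution q -> (forall i, x <= F i) -> x <= \sum_i q 0 i * F i.
Proof.
move=> [q0 q1] Fx; rewrite -[leLHS]mul1r -q1 mulr_suml.
by apply: ler_sum => i _; apply: ler_wpM2l.
Qed.

Lemma stochastic_exp P tau : is_stochastic P -> is_stochastic (P ^+ tau).
Proof.
move=> hP; elim: tau => [|tau IH] i.
  split=> [k|]; first by rewrite expr0 !mxE ler0n.
  rewrite (bigD1 i) //= expr0 !mxE eqxx big1 ?addr0 // => k ki.
  by rewrite !mxE eq_sym (negbTE ki).
have [P0 P1] := hP i; split=> [k|].
  rewrite exprS !mxE; apply: sumr_ge0 => l _; apply: mulr_ge0.
    by have := P0 l; rewrite mxE.
  by have [+ _] := IH l => /(_ k); rewrite mxE.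
under eq_bigr do rewrite exprS !mxE.
rewrite exchange_big /= -{}P1; apply: eq_bigr => l _.
rewrite -mulr_sumr mxE; have [_] := IH l.
by under eq_bigr do rewrite mxE; move=> ->; rewrite mulr1.
Qed.

(** The bound on f improves by the factor beta at each step, so it can be
    replaced by beta ^+ k times itself for every k. *)
Lemma contraction_le0 (T : Type) (D : T -> Prop) (f : T -> R) (beta M : R) :
  0 <= beta < 1 -> 0 <= M -> (forall t, D t -> f t <= M) ->
  (forall c, 0 <= c -> (forall t, D t -> f t <= c) ->
     forall t, D t -> f t <= beta * c) ->
  forall t, D t -> f t <= 0.
Proof.
move=> /andP[b0 b1] M0 fM contr t Dt.
have iter_le k : forall t, D t -> f t <= M * beta ^+ k.
  elim: k => [|k IH] s Ds; first by rewrite expr0 mulr1 fM.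
  rewrite exprS mulrCA; apply: contr => //.
  by rewrite mulr_ge0// exprn_ge0.
have lim0 : M * beta ^+ k @[k --> \oo] --> (0 : R).
  rewrite -(mulr0 M); apply: cvgMl_tmp; apply: cvg_expr.
  by rewrite ger0_norm.
have <- := cvg_lim (@Rhausdorff R) lim0.
apply: limr_ge; first by apply/cvg_ex; exists 0.
by apply: nearW => k; apply: iter_le.
Qed.

Definition le_on_beliefs P V1 V2 : Prop :=
  forall j tau, (1 <= tau)%N -> V1 (belief P j tau) <= V2 (belief P j tau).

(** The slack c is what makes domination usable inside the contraction
    argument: besides ordering the two continuations it says that they do not
    amplify a constant excess. *)
Definition dominated P (C1 C2 : @continuation R n) : Prop :=
  forall V1 V2 c, le_on_beliefs P V1 (fun b => V2 b + c) ->
  forall j tau, C1 V1 j tau <= C2 V2 j tau + c.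

(** All the continuations of the model involve only the values at the beliefs
    (i, 1), which reduces domination to comparing averages and extrema of two
    finite families of values. *)
Lemma dominatedP P (C1 C2 : continuation) :
  (forall V1 V2 c, (forall i, V1 (belief P i 1) <= V2 (belief P i 1) + c) ->
     forall j tau, C1 V1 j tau <= C2 V2 j tau + c) ->
  dominated P C1 C2.
Proof. by move=> h V1 V2 c le12; apply: h => i; apply: le12. Qed.

Lemma dominated_min_min P : dominated P (cont_min P) (cont_min P).
Proof.
apply: dominatedP => V1 V2 c le12 j tau; rewrite -lerBlDr.
apply: le_min_ord => i; rewrite lerBlDr; apply: le_trans (le12 i).
exact: (min_ord_le (fun i => V1 (belief P i 1))).
Qed.

Lemma dominated_min_average P (q : 'I_n.+1 -> nat -> 'rV[R]_n.+1) :
  (forall j tau, is_distribution (q j tau)) ->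
  dominated P (cont_min P)
    (fun V j tau => \sum_i q j tau 0 i * V (belief P i 1)).
Proof.
move=> hq; apply: dominatedP => V1 V2 c le12 j tau; rewrite -lerBlDr.
apply: average_ge => // i; rewrite lerBlDr; apply: le_trans (le12 i).
exact: (min_ord_le (fun i => V1 (belief P i 1))).
Qed.

Lemma dominated_average_max P (q : 'I_n.+1 -> nat -> 'rV[R]_n.+1) :
  (forall j tau, is_distribution (q j tau)) ->
  dominated P (fun V j tau => \sum_i q j tau 0 i * V (belief P i 1))
    (cont_max P).
Proof.
move=> hq; apply: dominatedP => V1 V2 c le12 j tau.
apply: average_le => // i; apply: le_trans (le12 i) _.
by rewrite lerD2r; exact: (le_max_ord (fun i => V2 (belief P i 1))).
Qed.

Lemma cont_origE P :
  cont_orig P =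
    fun V j tau => \sum_i row j (P ^+ tau) 0 i * V (belief P i 1).
Proof.
by do 3!apply/funext => ?; apply: eq_bigr => i _; rewrite mxE.
Qed.

(** If V1 <= V2 + c on belief states, both branches of the maximum for V1
    exceed the corresponding branch for V2 by at most beta * c: the passive one
    by the bound at the next belief, the active one by domination.  So V1 - V2
    is contracted to a nonpositive function.  V1 is a subsolution rather than a
    solution in order to cover the zero function. *)
Lemma bellman_comparison P rew W beta (C1 C2 : continuation) V1 V2 :
  0 <= beta < 1 -> dominated P C1 C2 ->
  bounded_on_beliefs P V1 -> bounded_on_beliefs P V2 ->
  (forall j tau, (1 <= tau)%N -> V1 (belief P j tau) <=
     Num.max (rew (belief P j tau) false + W + beta * V1 (belief P j tau.+1))
             (rew (belief P j tau) true + beta * C1 V1 j tau)) ->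
  bellman P rew W beta C2 V2 ->
  le_on_beliefs P V1 V2.
Proof.
move=> b01 dom [M1 bd1] [M2 bd2] sub1 eq2 j tau tau1.
have /andP[b0 _] := b01.
have M0 : 0 <= M1 + M2.
  by rewrite addr_ge0// (le_trans (normr_ge0 _) (bd1 j _ tau1),
                          le_trans (normr_ge0 _) (bd2 j _ tau1)).
rewrite -subr_le0.
pose f (t : 'I_n.+1 * nat) := V1 (belief P t.1 t.2) - V2 (belief P t.1 t.2).
apply: (@contraction_le0 _ (fun t => 1 <= t.2)%N f beta (M1 + M2) b01 M0 _ _
  (j, tau)) => //.
  move=> [i s] /= s1; rewrite /f /=.
  apply: le_trans (ler_norm _) _; apply: le_trans (ler_normB _ _) _.
  by rewrite lerD ?bd1 ?bd2.
move=> c c0 fc [i s] /= s1; rewrite /f /= lerBlDr.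
have le12 : le_on_beliefs P V1 (fun b => V2 b + c).
  by move=> k r r1; have := fc (k, r) r1; rewrite /f /= lerBlDr addrC.
apply: le_trans (sub1 i s s1) _; rewrite eq2// addr_maxr ge_max !le_max.
apply/andP; split; apply/orP; [left|right]; rewrite addrCA lerD2l -mulrDr.
  by apply: ler_wpM2l => //; rewrite addrC le12.
by apply: ler_wpM2l => //; rewrite addrC; apply: dom.
Qed.

Lemma value_function_le P rew W C1 C2 (V1 V2 : R -> 'rV[R]_n.+1 -> R) :
  dominated P C1 C2 ->
  is_value_function P rew W C1 V1 -> is_value_function P rew W C2 V2 ->
  forall beta, 0 <= beta < 1 -> le_on_beliefs P (V1 beta) (V2 beta).
Proof.
move=> dom h1 h2 beta b01; have [bd1 eq1] := h1 _ b01.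
have [bd2 eq2] := h2 _ b01.
by apply: bellman_comparison b01 dom bd1 bd2 _ eq2 => j tau /eq1 <-.
Qed.

Lemma average_reward_le P (V1 V2 : R -> 'rV[R]_n.+1 -> R) g1 g2 :
  is_average_reward P V1 g1 -> is_average_reward P V2 g2 ->
  (forall beta, 0 <= beta < 1 -> le_on_beliefs P (V1 beta) (V2 beta)) ->
  g1 <= g2.
Proof.
move=> h1 h2 le12.
apply: ler_cvg_to (h1 ord0 _ (leqnn 1)) (h2 ord0 _ (leqnn 1)) _.
near=> beta.
have b1 : beta < 1 by near: beta; exact: nbhs_left_lt.
have b0 : 0 <= beta by near: beta; exact: nbhs_left_ge.
by rewrite ler_wpM2l ?subr_ge0 ?(ltW b1)// le12// b0.
Unshelve. all: by end_near. Qed.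

(** The zero function is a subsolution of the minimum problem: the active
    action pays R1 >= 0 and the minimum of zero values is zero. *)
Lemma average_min_ge0 P rew W (R1 : R) (Vmin : R -> 'rV[R]_n.+1 -> R) gmin :
  0 <= R1 ->
  (forall j tau, (1 <= tau)%N -> rew (belief P j tau) true = R1) ->
  is_value_function P rew W (cont_min P) Vmin ->
  is_average_reward P Vmin gmin -> 0 <= gmin.
Proof.
move=> R10 hactive hV hg.
apply: (@average_reward_le P (fun _ _ => 0) Vmin) => //.
  by move=> j tau _; under eq_fun do rewrite mulr0; exact: cvg_cst.
move=> beta b01; have [bd eqV] := hV _ b01; have /andP[b0 _] := b01.
apply: bellman_comparison b01 (dominated_min_min P) _ bd _ eqV.
  by exists 0 => j tau _; rewrite normr0.
move=> j tau tau1; rewrite le_max hactive//; apply/orP; right.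
by rewrite addr_ge0// mulr_ge0//; apply: le_min_ord.
Qed.

End Comparison.

Lemma relative_error_le (R : realType) (g a gmin gmax : R) :
  0 < gmin -> gmin <= g -> g <= gmax -> 0 <= a ->
  `|1 - a / g| <= Num.max (1 - a / gmax) (a / gmin - 1).
Proof.
move=> m0 mg gM a0; have g0 := lt_le_trans m0 mg.
have M0 := lt_le_trans g0 gM.
rewrite le_max; have [ag|ga] := leP a g; apply/orP; [left|right].
  rewrite ger0_norm ?subr_ge0 ?ler_pdivrMr ?mul1r//.
  by rewrite lerB// ler_wpM2l// lef_pV2.
rewrite ler0_norm ?opprB ?subr_le0 ?ler_pdivlMr ?mul1r ?(ltW ga)//.
by rewrite lerB// ler_wpM2l// lef_pV2.
Qed.

Theorem proposition2 (R : realType) (n : nat)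
  (P : 'M[R]_n.+1) (ps : 'rV[R]_n.+1)
  (rew : 'rV[R]_n.+1 -> bool -> R) (R1 W : R)
  (V Vapp Vmax Vmin : R -> 'rV[R]_n.+1 -> R)
  (g gapp gmax gmin : R)
  (hP : is_stochastic P)
  (hps : is_steady_state P ps)
  (hmaxp : forall (j : 'I_n.+1) (tau tau' : nat),
     (1 <= tau)%N -> (tau <= tau')%N ->
     max_ord (fun i => (P ^+ tau') j i) <= max_ord (fun i => (P ^+ tau) j i))
  (hactive : forall (j : 'I_n.+1) (tau : nat), (1 <= tau)%N ->
     rew (belief P j tau) true = R1)
  (hpassive : forall (j : 'I_n.+1) (tau tau' : nat),
     (1 <= tau)%N -> (tau <= tau')%N ->
     [/\ rew (belief P j tau) false <= R1,
         rew (belief P j tau') false <= rew (belief P j tau) false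
       & 0 <= rew (belief P j tau') false])
  (hV : is_value_function P rew W (cont_orig P) V)
  (hVapp : is_value_function P rew W (cont_app P ps) Vapp)
  (hVmax : is_value_function P rew W (cont_max P) Vmax)
  (hVmin : is_value_function P rew W (cont_min P) Vmin)
  (hg : is_average_reward P V g)
  (hgapp : is_average_reward P Vapp gapp)
  (hgmax : is_average_reward P Vmax gmax)
  (hgmin : is_average_reward P Vmin gmin)
  (g_neq0 : g != 0) (gmax_neq0 : gmax != 0) (gmin_neq0 : gmin != 0) :
  `|1 - gapp / g| <= Num.max (1 - gapp / gmax) (gapp / gmin - 1).
Proof.
have [rewR1 _ rew0] := hpassive ord0 1%N 1%N (leqnn 1) (leqnn 1).
have hrow j tau : is_distribution (row j (P ^+ tau)).
  exact: stochastic_exp.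
have gmin_gt0 : 0 < gmin.
  rewrite lt_def gmin_neq0 /=.
  by apply: average_min_ge0 (le_trans rew0 rewR1) hactive hVmin hgmin.
rewrite cont_origE in hV.
apply: relative_error_le => //.
- apply: (average_reward_le _ _ _ _ _ hgmin hg).
  apply: value_function_le hVmin hV.
  exact: dominated_min_average.
- apply: (average_reward_le _ _ _ _ _ hg hgmax).
  apply: value_function_le hV hVmax.
  exact: dominated_average_max.
- apply: le_trans (ltW gmin_gt0) _.
  apply: (average_reward_le _ _ _ _ _ hgmin hgapp).
  apply: value_function_le hVmin hVapp.
  by apply: (@dominated_min_average _ _ P (fun _ _ => ps)) => _ _; case: hps.
Qed.
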